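(* There is an absolute constant $C>0$ such that for every $n$ and every graph $H\subseteq K_n$ with at least one edge, $$p_{\mathbb E}^{*}(H)\le C\,p_{\mathbb E}(H)\log(2e(H))\qquad\text{and}\qquad p_{\mathrm c}(H)\le C\,p_{\mathbb E}(H)\log^2(2e(H)).$$
   Context: All graphs are finite and simple; $e(G)$ is the number of edges of $G$. A graph is nonempty if it has at least one edge; isolated vertices are omitted. Containment is as a (not necessarily induced) subgraph. Logarithms are natural. A copy of $I$ in $G$ is a subgraph of $G$ isomorphic to $I$, and $N_I(G)$ is the number of such copies. $G_{n,p}$ is the random graph on $[n]$ in which each edge of $K_n$ is present independently with probability $p$. Threshold: $p_{\mathrm c}(H):=\inf\{p\in[0,1]:\mathbb P(G_{n,p}\text{ contains a copy of }H)\ge 1/2\}$. Graphic expectation threshold: $p_{\mathbb E}(H):=\inf\{p\in[0,1]: N_I(K_n)p^{e(I)}\ge 1/2\text{ for every nonempty } I\subseteq H\}$. Fractional expectation threshold: a fractional cover of the copies of $H$ in $K_n$ assigns weights $w_A\ge0$ to the sets $A\subseteq E(K_n)$ such that $\sum_{A\subseteq E(S)}w_A\ge1$ for every copy $S$ of $H$ in $K_n$; its cost at $p$ is $\sum_A w_Ap^{|A|}$. Then $p_{\mathbb E}^{*}(H)$ is the supremum of the $p\in[0,1]$ for which some fractional cover has cost at most $1/2$ at $p$. *)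

(* Defs.v *)
From mathcomp Require Import all_boot all_order all_algebra.
From mathcomp Require Import classical_sets reals exp.

Set Implicit Arguments.
Unset Strict Implicit.
Unset Printing Implicit Defensive.

Import Order.TTheory GRing.Theory Num.Theory.

Local Open Scope ring_scope.

(* Isolated vertices play no role, so a graph on the vertex set 'I_n is encoded
   by its edge set, a set G of 2-element subsets of 'I_n (G \subset K_ n); its
   vertex set is finset.cover G and its number of edges is #|G|. *)
Notation graph n := {set {set 'I_n}}.

Definition K_ (n : nat) : graph n := [set e : {set 'I_n} | #|e| == 2%N]%SET.

Definition isomorphic (n : nat) (I S : graph n) : bool :=
  [exists f : {ffun 'I_n -> 'I_n},
     dinjectiveb f (finset.cover I) &&
     ([set f @: (e : {set 'I_n}) | e in I]%SET == S)].

Definition copies (n : nat) (I G : graph n) : {set graph n} :=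
  [set S : graph n | (S \subset G) && isomorphic I S]%SET.

Definition num_copies (n : nat) (I G : graph n) : nat := #|copies I G|.

Definition contains_copy (n : nat) (G H : graph n) : bool :=
  (0 < num_copies H G)%N.

Section Thresholds.
Variables (R : realType) (n : nat).
Implicit Types (p : R) (H G I S A : graph n).
Local Open Scope classical_set_scope.

(* The probability that G_{n,p} = G, by independence of the edges. *)
Definition Gnp_mass p G : R :=
  \prod_(e in K_ n) (if e \in G then p else 1 - p).

Definition Gnp_prob p (E : pred (graph n)) : R :=
  \sum_(G : graph n | (G \subset K_ n) && E G) Gnp_mass p G.

Definition threshold H : R :=
  inf [set p : R | 0 <= p <= 1 /\
                   1 / 2 <= Gnp_prob p (fun G => contains_copy G H)].

Definition graphic_expectation_threshold H : R :=
  inf [set p : R | 0 <= p <= 1 /\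
        forall I, I \subset H -> (0 < #|I|)%N ->
          1 / 2 <= (num_copies I (K_ n))%:R * p ^+ #|I|].

(* Only the weights w A with A \subset K_ n are relevant. *)
Definition fractional_cover H (w : graph n -> R) : Prop :=
  (forall A, A \subset K_ n -> 0 <= w A) /\
  (forall S, S \in copies H (K_ n) ->
     1 <= \sum_(A : graph n | A \subset S) w A).

Definition cover_cost (w : graph n -> R) p : R :=
  \sum_(A : graph n | A \subset K_ n) w A * p ^+ #|A|.

Definition fractional_expectation_threshold H : R :=
  sup [set p : R | 0 <= p <= 1 /\
        exists w, fractional_cover H w /\ cover_cost w p <= 1 / 2].

End Thresholds.

(* Main.v *)
(** Let the symmetric group act on edges, let [pi_J(H)] be the proportion of
    permutations carrying [J] into [H], and let [q] satisfy the constraints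
    defining p_E(H): every nonempty [I \subset H] has at least [q ^- #|I| / 2]
    copies in K_n, so [pi_I(H) <= 2 ^ #|H| * 2 * q ^ #|I|].

    Put [c = 8q] and take [I \subset H] of maximal size with
    [pi_I(H) >= c ^ #|I|].  The bound above forces [#|I| <= #|H| / 2], and
    maximality gives [pi_(I :|: J)(H) <= pi_I(H) * c ^ #|J :\: I|] for every
    translate of [J]; averaging over translates,
    [pi_J(H) <= E_g (c ^ #|gJ :\: I|)].  Expanding over the part of [J] sent into
    [I] and iterating [k ~ log_2 #|H|] times yields [pi_J(H) <= (8kq) ^ #|J|]:
    a uniformly random copy of [H] is (8kq)-spread.

    Weak linear programming duality turns this into p_E^*(H) <= 8kq.  For the
    threshold, spreadness feeds the minimum fragment argument of
    Frankston-Kahn-Narayanan-Park and Park-Pham: each of [k] rounds of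
    exposing a random edge set of density 16 * 8kq halves the size of the part
    of a copy that remains to be covered, with summable failure probabilities. *)

Require Import Defs.
From mathcomp Require Import all_boot all_order all_algebra all_fingroup.
From mathcomp Require Import classical_sets reals exp.
From mathcomp Require Import fintype finset.
From mathcomp Require Import ring lra zify.

Set Implicit Arguments.
Unset Strict Implicit.
Unset Printing Implicit Defensive.

Import Order.TTheory GRing.Theory Num.Theory.

Local Open Scope ring_scope.

(** * Counting group elements that carry one set into another *)

Section Embeddings.
Variables (aT : finGroupType) (T : finType) (to : {action aT &-> T}).
Implicit Types (A B H I J K : {set T}) (a b : aT).

(** The ratio [#|embeddings J H| / #|aT|] is the proportion [pi_J(H)]. *)
Definition embeddings J H : {set aT} := [set a | to^*%act J a \subset H]%SET.

Lemma mem_embeddings J H a :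
  (a \in embeddings J H) = (to^*%act J a \subset H).
Proof. by rewrite inE. Qed.

Lemma set_actionE A a : to^*%act A a = to^~ a @: A.
Proof. exact: setactE. Qed.

Lemma setact_subset A B a : (to^*%act A a \subset to^*%act B a) = (A \subset B).
Proof.
apply/idP/idP => [sAB|]; last by rewrite !set_actionE; exact: imsetS.
by move/(imsetS (to^~ a^-1%g)): sAB; rewrite -!set_actionE !(actK to^*).
Qed.

Lemma setactU A B a : to^*%act (A :|: B) a = to^*%act A a :|: to^*%act B a.
Proof. by rewrite !set_actionE imsetU. Qed.

(** Inversion of [a] swaps the two conditions. This turns bounds on embeddings into bounds on random
    translates containing a fixed set. *)
Lemma card_embeddings_sup A J :
  #|[set a | A \subset to^*%act J a]| = #|embeddings A J|.
Proof.
rewrite -(card_preimset (embeddings A J) (@invg_inj _)); apply: eq_card => a.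
by rewrite !inE -(setact_subset (to^*%act A _) _ a) actKV.
Qed.

Lemma card_embeddings_setact J H a :
  #|embeddings (to^*%act J a) H| = #|embeddings J H|.
Proof.
rewrite -(card_imset _ (mulgI a)); apply: eq_card => b; apply/imsetP/idP.
  by case=> c; rewrite !inE -actM => sJH ->.
rewrite inE => sJH; exists (a^-1 * b)%g; last by rewrite mulKVg.
by rewrite inE -actM mulKVg.
Qed.

(** The elements carrying [I] onto a given [S] are none or a coset of the stabiliser, and [H] has
    [2 ^ #|H|] subsets [S]. *)
Lemma card_embeddings_orbit I H :
  (#|embeddings I H| * #|orbit to^* [set: aT] I| <= 2 ^ #|H| * #|aT|)%N.
Proof.
have -> : #|embeddings I H| =
    (\sum_(S in powerset H) #|amove to^* [set: aT] I S|)%N.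
  rewrite -sum1_card (partition_big (to^*%act I) (mem (powerset H))) => [|a] /=.
    apply: eq_bigr => S; rewrite inE => sSH; rewrite -sum1_card.
    by apply: eq_bigl => a; rewrite !inE; apply: andb_idl => /eqP/= ->.
  by rewrite !inE.
rewrite -[#|aT|]cardsT -(card_orbit_stab to^* [set: aT] I) -card_powerset.
rewrite [(#|orbit _ _ _| * _)%N]mulnC mulnA leq_mul2r; apply/orP; right.
rewrite -sum_nat_const; apply: leq_sum => S _.
have [->|[a]] := set_0Vmem (amove to^* [set: aT] I S); first by rewrite cards0.
rewrite inE => /andP[aT_a /eqP <-].
by rewrite amove_act ?subsetT // card_rcoset.
Qed.

(** Double counting: [b] embeds the union iff [b] embeds [I] and [a * b] embeds [J]; for fixed [b],
    right multiplication by [b] is a bijection. *)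
Lemma sum_embeddings_setU (I J H : {set T}) :
  (#|embeddings I H| * #|embeddings J H| =
   \sum_a #|embeddings (I :|: to^*%act J a) H|)%N.
Proof.
under [RHS]eq_bigr => a _ do rewrite -sum1_card.
rewrite (exchange_big_dep (mem (embeddings I H))) => [|a b _]; last first.
  by rewrite /= !mem_embeddings setactU subUset => /andP[].
rewrite -sum_nat_const; apply: eq_bigr => b.
rewrite /= mem_embeddings => sIH; rewrite -(card_preimset _ (mulIg b)) -sum1_card.
apply: eq_bigl => a.
by rewrite mem_embeddings setactU subUset sIH -actM -mem_embeddings inE.
Qed.


Lemma id_embedding J H : J \subset H -> 1%g \in embeddings J H.
Proof. by rewrite inE act1. Qed.

End Embeddings.

(** * Expanding products over subsets *)

Section Binomial.
Variables (R : comPzSemiRingType) (T : finType).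

Lemma sum_subset_prod (U : {set T}) (f g : T -> R) :
  \sum_(W : {set T} | W \subset U) \prod_(e in U) (if e \in W then f e else g e)
  = \prod_(e in U) (f e + g e).
Proof.
have -> : \prod_(e in U) (f e + g e) =
    \prod_e ((if e \in U then f e else 0) + (if e \in U then g e else 1)).
  by rewrite big_mkcond; apply: eq_bigr => e _; case: ifP; rewrite ?add0r.
rewrite bigA_distr [LHS]big_mkcond; apply: eq_bigr => W _.
case: ifPn => [sWU | /subsetPn[e We Ue]].
  rewrite big_mkcond; apply: eq_bigr => e _.
  by case: (boolP (e \in U)) => // Ue; rewrite (contraNF (subsetP sWU e)).
by rewrite (bigD1 e) //= We (negPf Ue) mul0r.
Qed.

Lemma sum_subset_expr (U : {set T}) (x y : R) :
  \sum_(W : {set T} | W \subset U) x ^+ #|U :\: W| * y ^+ #|W|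
  = (x + y) ^+ #|U|.
Proof.
rewrite addrC -prodr_const -sum_subset_prod; apply: eq_bigr => W sWU.
rewrite (big_setID W) /= mulrC (setIidPr sWU) -!prodr_const.
congr (_ * _); apply: eq_bigr => e; first by move->.
by rewrite inE => /andP[/negPf->].
Qed.

End Binomial.

(** * Spreadness of random translates of a sparse set *)

Section Spread.
Variables (R : realFieldType) (aT : finGroupType) (T : finType).
Variable to : {action aT &-> T}.
Implicit Types (q : R) (H I J K : {set T}).

(** The constraints defining p_E(H), with the orbit of [I] in place of its copies. *)
Definition sparse q H := forall I, I \subset H -> (0 < #|I|)%N ->
  1 / 2 <= #|orbit to^* [set: aT] I|%:R * q ^+ #|I|.

Lemma embeddings_halving q H J : 0 <= q -> sparse q H ->
  exists I, [/\ I \subset H, (#|I| <= #|H|./2)%N &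
    #|embeddings to J H|%:R <= \sum_a (8 * q) ^+ #|to^*%act J a :\: I|].
Proof.
move=> q0 spH; set c := 8 * q.
have c0 : 0 <= c by rewrite mulr_ge0.
pose good I := (I \subset H) &&
  (c ^+ #|I| * #|aT|%:R <= #|embeddings to I H|%:R).
have good0 : good set0.
  rewrite /good sub0set cards0 expr0 mul1r ler_nat -cardsT subset_leq_card //.
  by apply/subsetP=> a _; rewrite inE set_actionE imset0 sub0set.
case: (arg_maxnP (fun I : {set T} => #|I|) good0) => I /andP[sIH cI] maxI.
have aT0 : 0 < #|aT|%:R :> R by rewrite ltr0n -cardsT cardG_gt0.
have emb0 : 0 < #|embeddings to I H|%:R :> R.
  by rewrite ltr0n card_gt0; apply/set0Pn; exists 1%g; exact: id_embedding.
exists I; split=> //.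
  (* Goodness, the orbit count and sparsity give [8 ^ #|I| <= 2 ^ (#|H| + 1)], so
     [3 * #|I| <= #|H| + 1]. *)
  rewrite leqNgt; apply/negP => ltHI.
  have I0 : (0 < #|I|)%N by exact: leq_ltn_trans ltHI.
  have := card_embeddings_orbit to I H; rewrite -(ler_nat R) !natrM => upb.
  have : c ^+ #|I| * #|orbit to^* [set: aT] I|%:R <= (2 ^ #|H|)%:R.
    rewrite -(ler_pM2r aT0) (le_trans _ upb) // mulrAC.
    by rewrite ler_wpM2r ?ler0n.
  rewrite exprMn -mulrA [_ * #|_|%:R]mulrC => {}upb.
  have /le_trans/(_ upb) := ler_wpM2l (exprn_ge0 #|I| (ler0n R 8)) (spH I sIH I0).
  rewrite mulrA mulr1 ler_pdivrMr ?ltr0n // -natrX -natrM ler_nat.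
  by rewrite -expnSr -[8%N]/(2 ^ 3)%N -expnM leq_exp2l //; lia.
rewrite -(ler_pM2l emb0) -natrM sum_embeddings_setU natr_sum mulr_sumr.
apply: ler_sum => a _; set K := to^*%act J a.
have [sKI|nsKI] := boolP (K \subset I).
  have /eqP-> : K :\: I == set0 by rewrite setD_eq0.
  by rewrite (setUidPl sKI) cards0 expr0 mulr1.
have [->|[b]] := set_0Vmem (embeddings to (I :|: K) H).
  by rewrite cards0 mulr_ge0 ?exprn_ge0.
(* [I :|: K] need not lie in [H], but its translate by [b] does and has as many embeddings; if the
   bound failed, this translate would be good and larger than [I]. *)
rewrite inE => sIKH; rewrite leNgt; apply/negP => ltK.
have /maxI : good (to^*%act (I :|: K) b).
  rewrite /good sIKH /= card_setact card_embeddings_setact.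
  rewrite (le_trans _ (ltW ltK)) // cardsU cardsD (setIC K).
  rewrite -addnBA ?subset_leq_card ?subsetIr // exprD mulrAC.
  by rewrite ler_wpM2r ?exprn_ge0.
rewrite /= card_setact /geq /= leqNgt => /negP[].
by rewrite proper_card // properE subsetUl subUset subxx.
Qed.

Lemma embeddings_spread q k H J : 0 <= q -> sparse q H -> (#|H| < 2 ^ k)%N ->
  #|embeddings to J H|%:R <= (8 * k%:R * q) ^+ #|J| * #|aT|%:R.
Proof.
move=> q0; elim: k H J => [|k IHk] H J spH.
  rewrite expn0 ltnS leqn0 cards_eq0 => /eqP->.
  have [->|J0] := eqVneq J set0.
    by rewrite cards0 expr0 mul1r ler_nat max_card.
  rewrite [embeddings _ _ _](_ : _ = set0) ?cards0 ?mulr_ge0 ?exprn_ge0 //.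
    by rewrite !mulr_ge0.
  apply/eqP; rewrite -subset0; apply/subsetP=> a; rewrite inE subset0.
  by rewrite -cards_eq0 card_setact cards_eq0 (negPf J0).
move=> ltH; have [I [sIH leIH leJ]] := embeddings_halving J q0 spH.
have ltI : (#|I| < 2 ^ k)%N by rewrite expnS in ltH; lia.
have spI : sparse q I by move=> K sKI; apply: spH; exact: subset_trans sIH.
apply: le_trans leJ _.
(* The summands weigh the elements of [J] sent outside [I] and into [I]; the binomial expansion runs
   over the part [K] sent into [I]. *)
have -> : 8 * k.+1%:R * q = 8 * q + 8 * k%:R * q.
  by rewrite -natr1; ring.
rewrite -sum_subset_expr mulr_suml.
apply: (@le_trans _ _ (\sum_a \sum_(K : {set T} | K \subset J)
    if to^*%act K a \subset I then (8 * q) ^+ #|J :\: K| else 0)).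
  apply: ler_sum => a _; set K := to^*%act (to^*%act J a :&: I) a^-1%g.
  have Ka : to^*%act K a = to^*%act J a :&: I by exact: actKV.
  have sKJ : K \subset J by rewrite -(setact_subset to _ _ a) Ka subsetIl.
  rewrite (bigD1 K) //= [X in if X then _ else _](_ : _ = true); last first.
    by rewrite -/(to^*%act K a) Ka subsetIr.
  have -> : #|J :\: K| = #|to^*%act J a :\: I|.
    by rewrite cardsDS // cardsD -Ka !(card_setact to).
  by rewrite lerDl; apply: sumr_ge0 => L _; case: ifP; rewrite ?exprn_ge0 ?mulr_ge0.
(* For fixed [K] the inner sum counts the embeddings of [K] into [I], where induction applies. *)
rewrite exchange_big; apply: ler_sum => K sKJ /=.
rewrite -big_mkcond sumr_const -[_ *+ #|_|]mulr_natr.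
rewrite -(mulrA (_ ^+ _)) ler_wpM2l ?exprn_ge0 ?mulr_ge0 //.
apply: le_trans (IHk I K spI ltI).
by rewrite ler_nat; apply: eq_leq; apply: eq_card => a; rewrite inE.
Qed.
End Spread.

(** * Random subsets with independent elements *)

Section RandomSubset.
Variables (R : realFieldType) (T : finType) (U : {set T}).
Implicit Types (p s : R) (W A Z : {set T}) (E : pred {set T}).

Definition subset_mass p W : R := \prod_(e in U) (if e \in W then p else 1 - p).

Definition subset_prob p E : R :=
  \sum_(W : {set T} | (W \subset U) && E W) subset_mass p W.

Lemma subset_mass_ge0 p W : 0 <= p <= 1 -> 0 <= subset_mass p W.
Proof.
by case/andP=> p0 p1; apply: prodr_ge0 => e _; case: ifP; rewrite ?subr_ge0.
Qed.

Lemma sum_subset_mass p : \sum_(W : {set T} | W \subset U) subset_mass p W = 1.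
Proof.
by rewrite sum_subset_prod big1 // => e _; rewrite addrC subrK.
Qed.

Lemma subset_prob_ge0 p E : 0 <= p <= 1 -> 0 <= subset_prob p E.
Proof. by move=> p01; apply: sumr_ge0 => W _; exact: subset_mass_ge0. Qed.

Lemma subset_prob_le p E E' : 0 <= p <= 1 -> (forall W, E W -> E' W) ->
  subset_prob p E <= subset_prob p E'.
Proof.
move=> p01 sEE'; rewrite /subset_prob !big_mkcondr /=.
apply: ler_sum => W _; case: ifP => [/sEE'->//|_].
by case: ifP => // _; exact: subset_mass_ge0.
Qed.

Lemma subset_probC p E : subset_prob p E = 1 - subset_prob p (predC E).
Proof.
by rewrite -(sum_subset_mass p) (bigID E) /= addrK.
Qed.

Lemma subset_prob_le1 p E : 0 <= p <= 1 -> subset_prob p E <= 1.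
Proof. by move=> p01; rewrite subset_probC lerBlDr lerDl subset_prob_ge0. Qed.

(** Element by element: lying in one of two independent random sets has probability
    [p + p' - p * p']. The factor [x] splits the indicator of [W1 :|: W2 = W] over [U]. *)
Lemma subset_mass_setU p p' W : W \subset U ->
  \sum_(W1 : {set T} | W1 \subset U) \sum_(W2 : {set T} | W2 \subset U)
     subset_mass p W1 * subset_mass p' W2 * (W1 :|: W2 == W)%:R
  = subset_mass (p + p' - p * p') W.
Proof.
move=> sWU; pose x (b1 b2 : bool) e : R := ((b1 || b2) == (e \in W))%:R.
transitivity (\sum_(W1 : {set T} | W1 \subset U) \prod_(e in U)
   (if e \in W1 then p * x true true e
    else (1 - p) * (p' * x false true e + (1 - p') * x false false e))).
  apply: eq_bigr => W1 sW1.
  transitivity (\sum_(W2 : {set T} | W2 \subset U) \prod_(e in U)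
   (if e \in W2 then (if e \in W1 then p else 1 - p) * p' * x (e \in W1) true e
    else (if e \in W1 then p else 1 - p) * (1 - p') * x (e \in W1) false e)).
    apply: eq_bigr => W2 sW2; rewrite -big_split /=.
    have -> : (W1 :|: W2 == W)%:R = \prod_(e in U) x (e \in W1) (e \in W2) e.
      case: eqP => [eqW|/eqP neW].
        by rewrite big1 // => e _; rewrite /x -eqW inE eqxx.
      have /exists_inP[e Ue We] : [exists (e | e \in U), (e \in W1 :|: W2) != (e \in W)].
        apply: contraR neW => /exists_inPn eqW; apply/eqP/setP => e.
        have [/eqW/negPn/eqP//|nUe] := boolP (e \in U).
        by rewrite (contraNF (subsetP sWU e) nUe) inE (contraNF (subsetP sW1 e) nUe)
          (contraNF (subsetP sW2 e) nUe).
      by rewrite (bigD1 e) //= /x -in_setU (negPf We) mul0r.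
    by rewrite -big_split /=; apply: eq_bigr => e _; case: (e \in W2).
  rewrite sum_subset_prod; apply: eq_bigr => e _; case: (e \in W1); rewrite /x /=; ring.
rewrite sum_subset_prod; apply: eq_bigr => e _; rewrite /x /=.
by case: (e \in W); rewrite /=; ring.
Qed.

Lemma subset_prob_setU p p' E :
  subset_prob (p + p' - p * p') E =
  \sum_(W1 : {set T} | W1 \subset U)
     subset_mass p W1 * subset_prob p' (fun W2 => E (W1 :|: W2)).
Proof.
rewrite /subset_prob.
under eq_bigr => W /andP[sWU _] do rewrite -subset_mass_setU //.
rewrite exchange_big /=; apply: eq_bigr => W1 sW1.
rewrite exchange_big mulr_sumr [RHS]big_mkcondr /=; apply: eq_bigr => W2 sW2.
have sW12 : W1 :|: W2 \subset U by rewrite subUset sW1.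
have [EW|nEW] := ifPn; last first.
  apply: big1 => W /andP[_ EW]; case: eqP => [eqW|]; rewrite ?mulr0 //.
  by rewrite eqW EW in nEW.
rewrite (bigD1 (W1 :|: W2)) ?sW12 //= eqxx mulr1 big1 ?addr0 // => W /andP[_].
by rewrite eq_sym => /negPf->; rewrite mulr0.
Qed.

(** An element of [A] contributes [p * (1 - p)] on the left and [p] on the right. This prices the
    passage from [W] to [W :|: A]. *)
Lemma subset_mass_setD p A Z : 0 <= p <= 1 -> A \subset Z -> Z \subset U ->
  p ^+ #|A| * subset_mass p (Z :\: A) <= subset_mass p Z.
Proof.
move=> /[dup] p01 /andP[p0 p1] sAZ sZU; have sAU := subset_trans sAZ sZU.
rewrite /subset_mass [X in _ * X](big_setID A) [leRHS](big_setID A) /=.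
rewrite (setIidPr sAU) -prodr_const mulrA.
have -> : \prod_(e in U :\: A) (if e \in Z :\: A then p else 1 - p) =
          \prod_(e in U :\: A) (if e \in Z then p else 1 - p).
  by apply: eq_bigr => e; rewrite !inE => /andP[->].
apply: ler_wpM2r; first by apply: prodr_ge0 => e _; case: ifP; rewrite ?subr_ge0.
rewrite -big_split; apply: ler_prod => e Ae; rewrite /= inE Ae (subsetP sAZ) //=.
by rewrite mulr_ge0 ?subr_ge0 //= ler_piMr // lerBlDr lerDl.
Qed.

(** * Minimum fragments *)

Section Fragments.
Variables (I : finType) (D : {set I}) (S : I -> {set T}).

(** Minimising over all members inside [S i :|: W], not just [S i], leaves few possible fragments
    once [W :|: fragment W i] is known. *)
Definition fragment_index W i :=
  [arg min_(j < i | (j \in D) && (S j \subset S i :|: W)) #|S j :\: W|].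

Definition fragment W i := S (fragment_index W i) :\: W.

Lemma fragment_indexP W i : i \in D ->
  [/\ fragment_index W i \in D, S (fragment_index W i) \subset S i :|: W &
    forall j, j \in D -> S j \subset S i :|: W -> (#|fragment W i| <= #|S j :\: W|)%N].
Proof.
move=> Di; rewrite /fragment /fragment_index; case: arg_minnP => [|j /andP[Dj sj] minj].
  by rewrite Di subsetUl.
by split=> // l Dl sl; apply: minj; rewrite Dl.
Qed.

Lemma fragment_sub W i : i \in D -> fragment W i \subset S i.
Proof. by move=> /(fragment_indexP W)[_ sW _]; rewrite subDset setUC. Qed.

(** The choice depends on [Z] alone, so its subsets are few candidates for a fragment. *)
Definition canonical_member Z : {set T} :=
  if [pick j | (j \in D) && (S j \subset Z)] is Some j then S j else set0.

(* Any member of the family inside W :|: fragment W i competes in the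
   minimization defining the fragment, hence leaves the whole fragment uncovered. *)
Lemma fragment_sub_canonical W i : i \in D ->
  fragment W i \subset canonical_member (W :|: fragment W i).
Proof.
move=> Di; have [Df sf minf] := fragment_indexP W Di.
rewrite /canonical_member; case: pickP => [j /andP[Dj sj]|/(_ (fragment_index W i))].
  have sjD : S j :\: W \subset fragment W i by rewrite subDset.
  have sji : S j \subset S i :|: W.
    apply: subset_trans sj _; rewrite subUset subsetUr /=.
    exact: subset_trans (fragment_sub W Di) (subsetUl _ _).
  have /eqP <- : S j :\: W == fragment W i by rewrite eqEcard sjD minf.
  exact: subsetDl.
by rewrite Df /= /fragment setDE setUIr setUCr setIT subsetUr.
Qed.

(** First moment over [W] and the fragment [A]: spreadness allows [s ^+ #|A| * N] indices, passing
    to [Z = W :|: A] costs [p ^- #|A|], and [Z] leaves at most [4 ^ (2 ^ k)] choices of [A]. With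
    [s / p <= 1 / 16] this gives [(4 / 16) ^+ (2 ^ k)]. *)
Lemma sum_large_fragments p s (N : R) k : 0 <= s -> 16 * s <= p -> p <= 1 ->
  (forall i, i \in D -> S i \subset U /\ (#|S i| < 2 ^ k.+1)%N) ->
  (forall A, #|[set i in D | A \subset S i]|%:R <= s ^+ #|A| * N) ->
  \sum_(W : {set T} | W \subset U)
     subset_mass p W * #|[set i in D | (2 ^ k <= #|fragment W i|)%N]|%:R
  <= N * (1 / 4) ^+ (2 ^ k).
Proof.
move=> s0 sp p1 SU spread; set a := (2 ^ k)%N.
have p01 : 0 <= p <= 1 by rewrite p1 (le_trans _ sp) // mulr_ge0.
have N0 : 0 <= N.
  by have := spread set0; rewrite cards0 expr0 mul1r; apply: le_trans.
pose bad W A := [&& A \subset U, A \subset canonical_member (W :|: A),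
  (a <= #|A|)%N & [disjoint W & A]].
apply: (@le_trans _ _ (\sum_(W : {set T} | W \subset U) \sum_(A | bad W A)
    subset_mass p W * (s ^+ #|A| * N))).
  apply: ler_sum => W sWU; rewrite -mulr_sumr ler_wpM2l ?subset_mass_ge0 //.
  apply: le_trans (ler_sum _ (fun A _ => spread A)); rewrite -natr_sum ler_nat.
  under [leqRHS]eq_bigr => A _ do rewrite -sum1_card.
  rewrite (exchange_big_dep (mem D)) /= => [|A i _]; last by rewrite inE => /andP[].
  rewrite -sum1_card big_mkcond [leqRHS]big_mkcond; apply: leq_sum => i _.
  rewrite inE; case: ifP => //= /andP[Di large]; rewrite Di.
  rewrite (bigD1 (fragment W i)) //= inE Di fragment_sub // !andbT.
  apply/and4P; split=> //; last by rewrite disjoint_sym disjoints_subset subsetDr.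
    by have [/(subset_trans (fragment_sub W Di))] := SU i Di.
  exact: fragment_sub_canonical.
have h16 : 0 <= 1 / 16 :> R by lra.
have step A Z : A \subset Z -> Z \subset U -> (a <= #|A|)%N ->
    subset_mass p (Z :\: A) * (s ^+ #|A| * N) <= subset_mass p Z * ((1 / 16) ^+ a * N).
  move=> sAZ sZU aA; rewrite mulrA [leRHS]mulrA ler_wpM2r //.
  have sA : s ^+ #|A| <= (1 / 16) ^+ a * p ^+ #|A|.
    apply: (@le_trans _ _ ((1 / 16) ^+ #|A| * p ^+ #|A|)).
      by rewrite -exprMn lerXn2r ?nnegrE //; [case/andP: p01 => p0 _; lra|lra].
    case/andP: p01 => p0 _; rewrite ler_wpM2r ?exprn_ge0 // ler_wiXn2l //; lra.
  apply: le_trans (ler_wpM2l (subset_mass_ge0 _ p01) sA) _.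
  rewrite mulrCA [leRHS]mulrC ler_wpM2l ?exprn_ge0 //.
  by rewrite mulrC subset_mass_setD.
apply: (@le_trans _ _ (\sum_(Z : {set T} | Z \subset U)
    \sum_(A : {set T} | A \subset canonical_member Z)
    subset_mass p Z * ((1 / 16) ^+ a * N))).
  rewrite (exchange_big_dep predT) //= [leRHS](exchange_big_dep predT) //=.
  apply: ler_sum => A _.
  have [aA|ltA] := leqP a #|A|; last first.
    rewrite big1 => [|W /andP[_ /and4P[_ _]]]; last by rewrite leqNgt ltA.
    by apply: sumr_ge0 => Z _; rewrite !mulr_ge0 ?subset_mass_ge0 ?exprn_ge0.
  (* Disjointness makes [W] recoverable as [Z :\: A]. *)
  rewrite (reindex_onto (fun Z => Z :\: A) (fun W => W :|: A)) /=; last first.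
    move=> W /andP[_ /and4P[_ _ _ dWA]]; apply/setP=> e; rewrite !inE.
    case: (boolP (e \in A)) => //= Ae; last by rewrite orbF.
    by apply/esym/negP => We; rewrite (disjointFr dWA We) in Ae.
  rewrite big_mkcond [leRHS]big_mkcond; apply: ler_sum => Z _.
  case: ifP => [/andP[/andP[sZU /and4P[sAU sAC _ _]] /eqP eqZ]|_]; last first.
    by case: ifP => // _; rewrite !mulr_ge0 ?subset_mass_ge0 ?exprn_ge0.
  have sAZ : A \subset Z by rewrite -eqZ subsetUr.
  have sZU' : Z \subset U by rewrite -eqZ subUset sZU.
  by rewrite eqZ in sAC; rewrite sZU' sAC step.
under eq_bigr => Z _ do rewrite sumr_const.
apply: (@le_trans _ _ (\sum_(Z : {set T} | Z \subset U)
   subset_mass p Z * ((1 / 4) ^+ a * N))); last first.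
  by rewrite -mulr_suml sum_subset_mass mul1r mulrC.
apply: ler_sum => Z _; rewrite -mulrnAr ler_wpM2l ?subset_mass_ge0 //.
rewrite -mulrnAl ler_wpM2r // -mulr_natr.
have -> : (1 / 4) ^+ a = (1 / 16) ^+ a * (2 ^ (2 * a))%:R :> R.
  by rewrite natrX exprM -exprMn; congr (_ ^+ _); field.
rewrite ler_wpM2l ?exprn_ge0 ?ler_nat //.
have -> : #|[pred A : {set T} | A \subset canonical_member Z]| =
  (2 ^ #|canonical_member Z|)%N.
  by rewrite -card_powerset; apply: eq_card => A; rewrite !inE.
rewrite leq_exp2l // /canonical_member; case: pickP => [j /andP[Dj _]|_].
  by have [_] := SU j Dj; rewrite expnS => /ltnW.
by rewrite cards0.
Qed.

End Fragments.

(** Induction on rounds. Indices with a large fragment are given up; the others form a family of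
    fragments, spread with the same [s] and [N] because fragments shrink the sets. The factor [#|D|]
    lets [D] shrink while [N] stays. The losses are [1/4 + 1/8 + ...]. *)
Lemma spread_avoid_prob (I : finType) p s (N : R) k (D : {set I}) (S : I -> {set T}) :
  0 <= s -> 16 * s <= p -> p <= 1 ->
  (forall i, i \in D -> S i \subset U /\ (#|S i| < 2 ^ k)%N) ->
  (forall A, #|[set i in D | A \subset S i]|%:R <= s ^+ #|A| * N) ->
  #|D|%:R * subset_prob (1 - (1 - p) ^+ k)
              (fun W => ~~ [exists (i | i \in D), S i \subset W])
  <= N * (1 / 2 - (1 / 2) ^+ k.+1).
Proof.
move=> s0 sp p1.
have p01 : 0 <= p <= 1 by rewrite p1 (le_trans _ sp) // mulr_ge0.
elim: k D S => [|k IHk] D S SU spread.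
  rewrite [X in N * X](_ : _ = 0) ?mulr0; last by rewrite expr1 subrr.
  have [->|[i Di]] := set_0Vmem D; first by rewrite cards0 mul0r.
  rewrite [subset_prob _ _]big1 ?mulr0 // => W /andP[_ /exists_inP[]].
  exists i => //; have [_] := SU i Di.
  by rewrite expn0 ltnS leqn0 cards_eq0 => /eqP->; exact: sub0set.
have N0 : 0 <= N.
  by have := spread set0; rewrite cards0 expr0 mul1r; apply: le_trans.
set pk := 1 - (1 - p) ^+ k.
have pk01 : 0 <= pk <= 1.
  have [q0 q1] : 0 <= 1 - p /\ 1 - p <= 1 by case/andP: p01; lra.
  by rewrite subr_ge0 exprn_ile1 //= lerBlDr lerDl exprn_ge0.
have -> : 1 - (1 - p) ^+ k.+1 = p + pk - p * pk by rewrite /pk exprS; ring.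
rewrite subset_prob_setU mulr_sumr.
pose L W := [set i in D | (2 ^ k <= #|fragment D S W i|)%N].
have hyp := sum_large_fragments s0 sp p1 SU spread.
apply: (@le_trans _ _ (\sum_(W : {set T} | W \subset U)
   (subset_mass p W * (N * (1 / 2 - (1 / 2) ^+ k.+1)) + subset_mass p W * #|L W|%:R))).
  apply: ler_sum => W sWU; rewrite mulrCA -mulrDr ler_wpM2l ?subset_mass_ge0 //.
  set E := fun W2 => _; pose D' := D :\: L W.
  have LD : L W \subset D by apply/subsetP=> i; rewrite inE => /andP[].
  have -> : #|D|%:R = #|D'|%:R + #|L W|%:R :> R.
    by rewrite -natrD cardsDS // subnK // subset_leq_card.
  rewrite mulrDl lerD ?ler_piMr ?subset_prob_le1 //.
  have D'P i : i \in D' -> i \in D /\ (#|fragment D S W i| < 2 ^ k)%N.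
    by rewrite !inE ltnNge; case: (i \in D) => //=; rewrite ?andbF ?andbT.
  apply: le_trans (IHk D' (fragment D S W) _ _).
  - rewrite ler_wpM2l // subset_prob_le // => W2; apply: contra.
    (* Covering the fragment completes the member at [fragment_index], possibly not [S i]. *)
    case/exists_inP=> i /D'P[Di _] sW2; apply/exists_inP.
    have [Df _ _] := fragment_indexP S W Di; exists (fragment_index D S W i) => //.
    by rewrite -subDset.
  - move=> i /D'P[Di lti]; split=> //; have [sSU _] := SU i Di.
    exact: subset_trans (fragment_sub _ _ Di) sSU.
  - move=> A; apply: le_trans (spread A); rewrite ler_nat subset_leq_card //.
    apply/subsetP=> i; rewrite inE => /andP[/D'P[Di _] sA]; rewrite inE Di.
    exact: subset_trans sA (fragment_sub _ _ Di).
rewrite big_split /= -mulr_suml sum_subset_mass mul1r.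
apply: le_trans (lerD (lexx _) hyp) _.
rewrite -mulrDr ler_wpM2l //.
(* This uses [k + 2 <= 2 * 2 ^ k]. *)
have : (1 / 4) ^+ (2 ^ k) <= (1 / 2) ^+ k.+2 :> R.
  have -> : 1 / 4 = (1 / 2) ^+ 2 :> R by field.
  rewrite -exprM ler_wiXn2l //; [lra|lra|].
  by have := ltn_expl k (isT : (1 < 2)%N); lia.
rewrite [(1 / 2) ^+ k.+2]exprS; lra.
Qed.

Lemma spread_contain_prob (I : finType) p s k (S : I -> {set T}) :
  (0 < #|I|)%N -> 0 <= s -> 16 * s <= p -> p <= 1 ->
  (forall i, S i \subset U /\ (#|S i| < 2 ^ k)%N) ->
  (forall A, #|[set i | A \subset S i]|%:R <= s ^+ #|A| * #|I|%:R) ->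
  1 / 2 <= subset_prob (1 - (1 - p) ^+ k) (fun W => [exists i, S i \subset W]).
Proof.
move=> I0 s0 sp p1 SU spread.
have spreadT A : #|[set i in [set: I] | A \subset S i]|%:R <= s ^+ #|A| * #|I|%:R.
  apply: le_trans (spread A); rewrite ler_nat subset_leq_card //.
  by apply/subsetP=> i; rewrite !inE.
have := spread_avoid_prob s0 sp p1 (fun i _ => SU i) spreadT.
rewrite cardsT mulrC [leRHS]mulrC.
rewrite ler_pM2r ?ltr0n // => fail_le.
rewrite subset_probC; set P := subset_prob _ _ in fail_le.
have -> : subset_prob (1 - (1 - p) ^+ k) (predC (fun W => [exists i, S i \subset W])) = P.
  apply: eq_bigl => W /=; congr (_ && ~~ _); apply: eq_existsb => i; by rewrite inE.
have : 0 <= (1 / 2) ^+ k.+1 :> R by rewrite exprn_ge0 //; lra.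
lra.
Qed.

End RandomSubset.

(** * Graphs under vertex permutations *)

Section Graphs.
Variable n : nat.
Implicit Types (G H I J S : graph n).

Local Notation edge_action := ('P^*)%act.
Local Notation graph_action := ('P^*^*)%act.

(** The complements of [A] and its image have equal size, so their enumerations match. Isomorphisms,
    injective only on covered vertices, thus extend to permutations. *)
Lemma injective_in_perm (T : finType) (A : {set T}) (f : T -> T) :
  {in A &, injective f} -> exists s : {perm T}, {in A, s =1 f}.
Proof.
move=> injf; pose B := ~: (f @: A).
pose g x := if x \in A then f x else nth x (enum B) (index x (enum (~: A))).
have ltB x : x \notin A -> (index x (enum (~: A)) < size (enum B))%N.
  have -> : size (enum B) = size (enum (~: A)).
    by rewrite -!cardE cardsCs setCK card_in_imset // [RHS]cardsCs setCK.
  by rewrite index_mem mem_enum inE.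
have gB x : x \notin A -> g x \in B.
  by move=> Ax; rewrite /g (negPf Ax) -mem_enum mem_nth ?ltB.
have injg : injective g.
  move=> x y; case: (boolP (x \in A)) (boolP (y \in A)) => [Ax|nAx] [Ay|nAy].
  - by rewrite /g Ax Ay; exact: injf.
  - move=> eqg; have := gB y nAy; rewrite -eqg /g Ax inE => /negP[].
    exact: imset_f.
  - move=> eqg; have := gB x nAx; rewrite eqg /g Ay inE => /negP[].
    exact: imset_f.
  rewrite /g (negPf nAx) (negPf nAy) (set_nth_default x y) ?ltB // => /eqP.
  rewrite nth_uniq ?enum_uniq ?ltB // => /eqP eqi.
  have := nth_index x (_ : x \in enum (~: A)); rewrite mem_enum inE => /(_ nAx) <-.
  by rewrite eqi nth_index // mem_enum inE.
by exists (perm injg) => x Ax; rewrite permE /g Ax.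
Qed.

Lemma isomorphic_orbit I S :
  isomorphic I S -> S \in orbit graph_action [set: {perm 'I_n}] I.
Proof.
case/existsP=> f /andP[/dinjectiveP injfI /eqP<-].
have [s sf] := injective_in_perm injfI.
apply/orbitP; exists s; rewrite ?inE // set_actionE; apply: eq_in_imset => e Ie.
rewrite set_actionE; apply: eq_in_imset => x ex; apply: sf.
by apply/bigcupP; exists e.
Qed.

Lemma isomorphic_setact H (s : {perm 'I_n}) : isomorphic H (graph_action H s).
Proof.
apply/existsP; exists [ffun x => s x]; apply/andP; split.
  by apply/dinjectiveP => x y _ _; rewrite !ffunE; exact: perm_inj.
rewrite set_actionE; apply/eqP; apply: eq_imset => e; rewrite set_actionE.
by apply: eq_imset => x; rewrite ffunE.
Qed.

Lemma setact_K_ H (s : {perm 'I_n}) : H \subset K_ n -> graph_action H s \subset K_ n.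
Proof.
move/subsetP=> sHK; rewrite set_actionE; apply/subsetP => _ /imsetP[e He ->].
by have := sHK e He; rewrite !inE card_setact.
Qed.

Lemma num_copies_orbit I G :
  (num_copies I G <= #|orbit graph_action [set: {perm 'I_n}] I|)%N.
Proof.
apply: subset_leq_card; apply/subsetP=> S; rewrite inE => /andP[_].
exact: isomorphic_orbit.
Qed.

Lemma setact_copies H G (s : {perm 'I_n}) :
  graph_action H s \subset G -> graph_action H s \in copies H G.
Proof. by move=> sHG; rewrite inE sHG isomorphic_setact. Qed.

Variable R : realType.
Implicit Types (p q : R).

Definition expectation_at_least_half q H :=
  forall I, I \subset H -> (0 < #|I|)%N ->
    1 / 2 <= (num_copies I (K_ n))%:R * q ^+ #|I|.

Lemma expectation_sparse q H : 0 <= q -> expectation_at_least_half q H ->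
  sparse edge_action q H.
Proof.
move=> q0 expH I sIH I0; apply: le_trans (expH I sIH I0) _.
by rewrite ler_wpM2r ?exprn_ge0 // ler_nat num_copies_orbit.
Qed.

(** Weak duality: sum the cover constraints over all translates of [H]; by spreadness a proportion
    at most [p ^+ #|A|] of them contains [A]. *)
Lemma cover_cost_spread q k H p (w : graph n -> R) :
  H \subset K_ n -> (#|H| < 2 ^ k)%N -> 0 <= q -> expectation_at_least_half q H ->
  8 * k%:R * q <= p -> fractional_cover H w -> 1 <= cover_cost w p.
Proof.
move=> sHK ltH q0 /(expectation_sparse q0) spH lep [w0 wcover].
have p0 : 0 <= 8 * k%:R * q by rewrite !mulr_ge0.
have aT0 : 0 < #|{: {perm 'I_n}}|%:R :> R by rewrite ltr0n -cardsT cardG_gt0.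
rewrite -(ler_pM2r aT0) mul1r.
apply: (@le_trans _ _ (\sum_(s : {perm 'I_n})
    \sum_(A : graph n | A \subset graph_action H s) w A)).
  rewrite -sum1_card natr_sum; apply: ler_sum => s _.
  by apply: wcover; rewrite setact_copies // setact_K_.
rewrite (exchange_big_dep (fun A : graph n => A \subset K_ n)) /=; last first.
  by move=> s A _ sA; apply: subset_trans sA (setact_K_ s sHK).
rewrite mulr_suml; apply: ler_sum => A sAK.
rewrite sumr_const -[_ *+ #|_|]mulr_natr -mulrA ler_wpM2l ?w0 //.
apply: (@le_trans _ _ #|embeddings edge_action A H|%:R).
  by rewrite -card_embeddings_sup ler_nat; apply: eq_leq; apply: eq_card => s; rewrite !inE.
apply: le_trans (embeddings_spread A q0 spH ltH) _.
by rewrite ler_wpM2r // lerXn2r ?nnegrE // (le_trans p0).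
Qed.

Lemma threshold_le H p : 0 <= p <= 1 ->
  1 / 2 <= Gnp_prob p (fun G => contains_copy G H) -> threshold R H <= p.
Proof.
by move=> p01 probH; apply: ge_inf; [exists 0 => x [/andP[]] | split].
Qed.

Lemma contains_copy_setact H G (s : {perm 'I_n}) :
  graph_action H s \subset G -> contains_copy G H.
Proof.
by move=> sHG; apply/card_gt0P; exists (graph_action H s); exact: setact_copies.
Qed.

Lemma threshold_le1 H : H \subset K_ n -> threshold R H <= 1.
Proof.
move=> sHK; apply: threshold_le; first by rewrite ler01 lexx.
rewrite /Gnp_prob (bigD1 (K_ n)) /=; last first.
  by rewrite subxx (contains_copy_setact (s := 1%g)) // act1.
rewrite [Gnp_mass _ _]big1 => [|e ->] //; rewrite -[leLHS]addr0 lerD //; first lra.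
by apply: sumr_ge0 => G _; apply: (subset_mass_ge0 (K_ n)); rewrite ler01 lexx.
Qed.

Lemma bernoulli_le p k : 0 <= p <= 1 -> 1 - (1 - p) ^+ k <= k%:R * p.
Proof.
case/andP=> p0 p1; elim: k => [|k IHk]; first by rewrite subrr mul0r.
have : (1 - p) ^+ k <= 1 by rewrite exprn_ile1 ?subr_ge0 // lerBlDr lerDl.
rewrite exprS -natr1; nra.
Qed.

(** Copies are indexed by permutations, with repetition. The [k] rounds of density [16 * s] have
    total density at most [k * 16 * 8kq]. *)
Lemma threshold_spread q k H :
  H \subset K_ n -> (0 < k)%N -> (#|H| < 2 ^ k)%N -> 0 <= q ->
  expectation_at_least_half q H -> threshold R H <= 128 * k%:R ^+ 2 * q.
Proof.
move=> sHK k0 ltH q0 /(expectation_sparse q0) spH.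
set s := 8 * k%:R * q; have s0 : 0 <= s by rewrite !mulr_ge0.
have -> : 128 * k%:R ^+ 2 * q = k%:R * (16 * s) by rewrite /s; ring.
have k1 : 1 <= k%:R :> R by rewrite ler1n.
(* If [16 * s] exceeds 1, so does the claimed bound. *)
have [sp|/ltW sp] := leP (16 * s) 1; last first.
  apply: le_trans (threshold_le1 sHK) _.
  by rewrite (le_trans sp) // ler_peMl // mulr_ge0.
have p01 : 0 <= 16 * s <= 1 by rewrite sp mulr_ge0.
apply: le_trans (bernoulli_le k p01); apply: threshold_le.
  case/andP: p01 => p0 _.
  have [r0 r1] : 0 <= 1 - 16 * s /\ 1 - 16 * s <= 1 by lra.
  by rewrite subr_ge0 exprn_ile1 //= lerBlDr lerDl exprn_ge0.
have := @spread_contain_prob R _ (K_ n) {perm 'I_n} (16 * s) s k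
  (fun a => graph_action H a).
move=> /(_ _ s0 (lexx _) sp); rewrite -cardsT cardG_gt0 => /(_ isT).
move=> contain; apply: le_trans (contain _ _) _.
- by move=> a; rewrite setact_K_ // card_setact.
- move=> A; rewrite [X in _ * X%:R]cardsT.
  apply: le_trans (embeddings_spread A q0 spH ltH).
  by rewrite -card_embeddings_sup.
apply: (@subset_prob_le R _ (K_ n)) => [|G /existsP[a]].
  case/andP: p01 => p0 _.
  have [r0 r1] : 0 <= 1 - 16 * s /\ 1 - 16 * s <= 1 by lra.
  by rewrite subr_ge0 exprn_ile1 //= lerBlDr lerDl exprn_ge0.
exact: contains_copy_setact.
Qed.

(** Bounds valid at every feasible [q] pass to the infimum, since [q = 1] is feasible. *)
Lemma graphic_expectation_threshold_ge H x c : H \subset K_ n -> 0 < c ->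
  (forall q, 0 <= q -> expectation_at_least_half q H -> x <= c * q) ->
  x <= c * graphic_expectation_threshold R H.
Proof.
move=> sHK c0 lex; rewrite mulrC -ler_pdivrMr //; apply: lb_le_inf.
  exists 1; split=> [|I sIH _]; first by rewrite ler01 lexx.
  have : (0 < num_copies I (K_ n))%N.
    by apply: (contains_copy_setact (s := 1%g)); rewrite act1 (subset_trans sIH).
  by rewrite expr1n mulr1 -(ler1n R); lra.
move=> q [/andP[q0 _] expH]; rewrite ler_pdivrMr // mulrC; exact: lex.
Qed.

End Graphs.

(** * Choice of constants and conclusion *)

Theorem mainTheorem4 (R : realType) :
  exists C : R, 0 < C /\
    forall (n : nat) (H : graph n), H \subset K_ n -> (0 < #|H|)%N ->
      fractional_expectation_threshold R H
        <= C * graphic_expectation_threshold R H * ln (2 * #|H|%:R) /\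
      threshold R H
        <= C * graphic_expectation_threshold R H * ln (2 * #|H|%:R) ^+ 2.
Proof.
have l0 : 0 < ln 2 :> R by rewrite ln_gt0 // ltr1n.
have l1 : ln 2 <= 1 :> R.
  by have := @le_ln1Dx R 1 _; rewrite -[1 + 1]/(2 : R); apply; lra.
(* Two factors [ln 2] convert the squared binary logarithm; the first bound needs one, and
   [ln 2 <= 1] absorbs the other. *)
exists (128 / ln 2 ^+ 2); split; first by rewrite divr_gt0 ?exprn_gt0.
move=> n H sHK H0; set L := ln (2 * #|H|%:R); pose k := (trunc_log 2 #|H|).+1.
have ltH : (#|H| < 2 ^ k)%N by exact: trunc_log_ltn.
pose x := L / ln 2; have eqL : L = x * ln 2 by rewrite divfK ?gt_eqF.
(* Since [2 ^ k <= 2 * #|H|], and [x] is the binary logarithm of [2 * #|H|]. *)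
have kx : k%:R <= x.
  rewrite ler_pdivlMr // mulr_natl -lnXn // /L ler_ln ?posrE ?exprn_gt0 //.
    by rewrite exprS ler_pM2l // -natrX ler_nat trunc_logP.
  by rewrite mulr_gt0 ?ltr0n.
have k1 : 1 <= k%:R :> R by rewrite ler1n.
have CL : 128 / ln 2 ^+ 2 * L = 128 * x / ln 2 by rewrite eqL; field; rewrite gt_eqF.
have CL2 : 128 / ln 2 ^+ 2 * L ^+ 2 = 128 * x ^+ 2 by rewrite eqL; field; rewrite gt_eqF.
have lex : 8 * k%:R <= 128 * x / ln 2.
  by rewrite ler_pdivlMr //; nra.
split; rewrite mulrAC ?CL ?CL2; apply: graphic_expectation_threshold_ge => //.
- by lra.
- move=> q q0 expH; rewrite /fractional_expectation_threshold.
  set E := (X in sup X); have [->|/set0P E0] := eqVneq E classical_sets.set0.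
    by rewrite sup0 mulr_ge0 //; lra.
  (* Beyond [8kq] every cover costs at least 1, above the allowed [1 / 2]. *)
  apply: ge_sup => // p [_ [w [covw costw]]]; rewrite leNgt; apply/negP => ltp.
  have : 1 <= cover_cost w p.
    apply: (cover_cost_spread sHK ltH q0 expH _ covw).
    by apply: le_trans (ltW ltp); rewrite ler_wpM2r.
  lra.
- by rewrite mulr_gt0 ?exprn_gt0 //; lra.
move=> q q0 expH; apply: le_trans (threshold_spread sHK _ ltH q0 expH) _ => //.
by rewrite ler_wpM2r // ler_wpM2l // lerXn2r ?nnegrE //; lra.
Qed.
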